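(* Let $\mathbf{s}$ be a sequence of pairs of positive integers, and let $n:=n(\mathbf{s})$. Then $$\begin{cases}\dfrac{n-4}{2}\leq\liminf\limits_{q\to\infty}\theta(\mathbf{s},q)\leq\limsup\limits_{q\to\infty}\theta(\mathbf{s},q)\leq\dfrac{n(n-2)}{4} & \text{if } n \text{ is even},\\[2ex] \dfrac{n-3}{2}\leq\liminf\limits_{q\to\infty}\theta(\mathbf{s},q)\leq\limsup\limits_{q\to\infty}\theta(\mathbf{s},q)\leq\dfrac{(n-1)^2}{4} & \text{if } n \text{ is odd}.\end{cases}$$
   Context: Throughout, $q$ ranges over prime powers and $k=\mathbb{F}_q$ is the finite field with $q$ elements. For a (finite, nonempty) sequence $\mathbf{s}=\{(e_1,f_1),\ldots,(e_t,f_t)\}$ of pairs of positive integers (repetitions allowed), put $n(\mathbf{s}):=\sum_i e_if_i$ and, for each $q$, let $B_{\mathbf{s}}:=\prod_{i=1}^t\mathbb{F}_{q^{e_i}}[X]/(X^{f_i})$, regarded as a $k$-algebra via the diagonal embedding of $k$; thus $n(\mathbf{s})=\dim_k B_{\mathbf{s}}$. For a finite $k$-algebra $B$, let $\mathcal{F}_0(k,B)$ be the set of $k$-subspaces $I$ of $B$ with $IB=B$. For a subset $I\subseteq B$ and $b\in B$ let $(I:b):=\{x\in B\mid bx\in I\}$. A closure operation on a partially ordered set is an extensive, order-preserving, idempotent self-map. A multiplicative operation on $(k,B,\mathcal{F}_0(k,B))$ is a closure operation $I\mapsto I^\star$ on $\mathcal{F}_0(k,B)$ (ordered by inclusion) such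 that $(I:b)^\star\subseteq(I^\star:b)$ for all $I\in\mathcal{F}_0(k,B)$ and all $b\in B$ with $(I:b)\in\mathcal{F}_0(k,B)$. A star operation on $(k,B)$ is a multiplicative operation $\star$ on $(k,B,\mathcal{F}_0(k,B))$ with $k^\star=k$; $\mathrm{Star}(k,B)$ is the set of all of them. Set $\Lambda(\mathbf{s},q):=|\mathrm{Star}(k,B_{\mathbf{s}})|$ and $\theta(\mathbf{s},q):=\log_q\log_2\Lambda(\mathbf{s},q)$, with the convention $\log_q 0=-\infty$.
   Formalization: The lower bounds on liminf θ(s,q) are asserted only for n ≥ 3: for n = 1 and n = 2 there is exactly one star operation, so θ(s,q) = −∞ for every q and the stated lower bound −1 fails; the other inequalities are kept for all n. *)

(* Defs.v *)
From HB Require Import structures.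
From mathcomp Require Import all_boot all_order all_algebra all_field.
From mathcomp Require Import all_classical all_reals all_analysis.

Set Implicit Arguments.
Unset Strict Implicit.
Unset Printing Implicit Defensive.

Import Order.TTheory GRing.Theory Num.Theory.

Local Open Scope ring_scope.

Section StarOperations.

(* A finite commutative k-algebra is given by its structure map. *)
Variables (k : finFieldType) (B : finComPzRingType) (iota : {rmorphism k -> B}).

Definition is_subspace (I : {set B}) : bool :=
  [&& 0 \in I,
      [forall x in I, forall y in I, x + y \in I] &
      [forall a : k, forall x in I, iota a * x \in I]].

(* The product IB: grouping by the elements of I, every finite sum of products
   x * b with x \in I has this form. *)
Definition extension (I : {set B}) : {set B} :=
  [set y | [exists c : {ffun B -> B}, y == \sum_(x in I) x * c x]].

Definition F0 : {set {set B}} :=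
  [set I : {set B} | is_subspace I && (extension I == [set: B])].

Definition F0_type := {I : {set B} | I \in F0}.

Definition base : {set B} := iota @: [set: k].

Lemma base_in_F0 : base \in F0.
Proof.
have iotaB a : iota a \in base by apply/imsetP; exists a; rewrite ?inE.
rewrite inE; apply/andP; split.
  apply/and3P; split; first by rewrite -(rmorph0 iota).
    apply/'forall_implyP => x /imsetP[a _ ->].
    by apply/'forall_implyP => y /imsetP[b _ ->]; rewrite -rmorphD.
  apply/forallP => a; apply/'forall_implyP => x /imsetP[b _ ->].
  by rewrite -rmorphM.
apply/eqP/setP => y; rewrite !inE; apply/existsP.
exists [ffun x => if x == 1 then y else 0].
rewrite (bigD1 1) -?(rmorph1 iota) //= rmorph1 ffunE eqxx mul1r.
by rewrite big1 ?addr0 // => x /andP[_ /negPf x1]; rewrite ffunE x1 mulr0.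
Qed.

Definition baseF0 : F0_type := exist _ base base_in_F0.

Definition residual (I : {set B}) (b : B) : {set B} := [set x | b * x \in I].

Definition is_closure (T : finType) (le : rel T) (c : T -> T) : bool :=
  [&& [forall x, le x (c x)],
      [forall x, forall y, le x y ==> le (c x) (c y)] &
      [forall x, c (c x) == c x]].

Definition F0_le : rel F0_type := fun I J => val I \subset val J.

(* J ranges over the residuals (I : b) that belong to F0. *)
Definition is_multiplicative (star : F0_type -> F0_type) : bool :=
  is_closure F0_le star &&
  [forall I : F0_type, forall b : B, forall J : F0_type,
     (val J == residual (val I) b) ==>
     (val (star J) \subset residual (val (star I)) b)].

Definition Star : {set {ffun F0_type -> F0_type}} :=
  [set star : {ffun F0_type -> F0_type} |
     is_multiplicative star && (star baseF0 == baseF0)].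

End StarOperations.

Section ProductRing.

Variables (J : finType) (A : J -> finComPzRingType).

Definition prod_ring : Type := {dffun forall j : J, A j}.

HB.instance Definition _ := Finite.on prod_ring.

Implicit Types x y z : prod_ring.

Definition prod_zero : prod_ring := [ffun j => 0 : A j].
Definition prod_one : prod_ring := [ffun j => 1 : A j].
Definition prod_opp x : prod_ring := [ffun j => - x j : A j].
Definition prod_add x y : prod_ring := [ffun j => x j + y j : A j].
Definition prod_mul x y : prod_ring := [ffun j => x j * y j : A j].

Fact prod_addA : associative prod_add.
Proof. by move=> x y z; apply/ffunP => j; rewrite !ffunE addrA. Qed.
Fact prod_addC : commutative prod_add.
Proof. by move=> x y; apply/ffunP => j; rewrite !ffunE addrC. Qed.
Fact prod_add0 : left_id prod_zero prod_add.
Proof. by move=> x; apply/ffunP => j; rewrite !ffunE add0r. Qed.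
Fact prod_addN : left_inverse prod_zero prod_opp prod_add.
Proof. by move=> x; apply/ffunP => j; rewrite !ffunE addNr. Qed.

HB.instance Definition _ :=
  GRing.isZmodule.Build prod_ring prod_addA prod_addC prod_add0 prod_addN.

Fact prod_mulA : associative prod_mul.
Proof. by move=> x y z; apply/ffunP => j; rewrite !ffunE mulrA. Qed.
Fact prod_mulC : commutative prod_mul.
Proof. by move=> x y; apply/ffunP => j; rewrite !ffunE mulrC. Qed.
Fact prod_mul1 : left_id prod_one prod_mul.
Proof. by move=> x; apply/ffunP => j; rewrite !ffunE mul1r. Qed.
Fact prod_mulDl : left_distributive prod_mul +%R.
Proof. by move=> x y z; apply/ffunP => j; rewrite !ffunE mulrDl. Qed.

HB.instance Definition _ :=
  GRing.Zmodule_isComPzRing.Build prod_ring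
    prod_mulA prod_mulC prod_mul1 prod_mulDl.

Variables (k : pzRingType) (f : forall j, {rmorphism k -> A j}).

Definition diagonal (a : k) : prod_ring := [ffun j => f j a : A j].

Fact diagonal_is_zmod_morphism : zmod_morphism diagonal.
Proof. by move=> a b; apply/ffunP => j; rewrite !ffunE rmorphB. Qed.
Fact diagonal_is_monoid_morphism : monoid_morphism diagonal.
Proof.
split=> [|a b]; apply/ffunP => j; rewrite !ffunE ?rmorph1 //.
by rewrite rmorphM.
Qed.

HB.instance Definition _ :=
  GRing.isZmodMorphism.Build k prod_ring diagonal diagonal_is_zmod_morphism.
HB.instance Definition _ :=
  GRing.isMonoidMorphism.Build k prod_ring diagonal diagonal_is_monoid_morphism.

End ProductRing.

Section FiniteFields.

Lemma frob_poly_neq0 (k : finFieldType) (e : nat) :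
  (0 < e)%N -> 'X^(#|k| ^ e) - 'X != 0 :> {poly k}.
Proof.
move=> e_gt0; have q_gt1: (1 < #|k| ^ e)%N.
  by rewrite -(expn0 #|k|) ltn_exp2l ?finNzRing_gt1.
by rewrite -size_poly_gt0 size_polyDl ?size_polyXn // size_polyN size_polyX.
Qed.

(* The extension of k of degree e > 0, as the splitting field of
   X ^ (q ^ e) - X; the value for e = 0 is irrelevant. *)
Definition ext_field (k : finFieldType) (e : nat) : splittingFieldType k :=
  if @idP (0 < e)%N is ReflectT e_gt0
  then sval (FinSplittingFieldFor (frob_poly_neq0 k e_gt0))
  else k^o.

Definition finite_ext (k : finFieldType) (e : nat) : finFieldType :=
  finvect_type (ext_field k e).

Definition prime_power (q : nat) : Prop :=
  exists p m : nat, [/\ prime p, (0 < m)%N & q = (p ^ m)%N].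

(* The field with q elements when q is a prime power. *)
Definition GF (q : nat) : finFieldType :=
  finite_ext 'F_(pdiv q) (logn (pdiv q) q).

End FiniteFields.

Section Algebra.

Variable k : finFieldType.

Definition truncated (ef : nat * nat) : finComPzRingType :=
  {poly %/ ('X^(ef.2) : {poly finite_ext k ef.1})}.

Definition truncated_map (ef : nat * nat) : {rmorphism k -> truncated ef} :=
  qpolyC ('X^(ef.2) : {poly finite_ext k ef.1})
    \o in_alg (ext_field k ef.1).

Variable s : seq (nat * nat).

Definition B_alg : finComPzRingType :=
  prod_ring (fun i : 'I_(size s) => truncated (tnth (in_tuple s) i)).

Definition B_map : {rmorphism k -> B_alg} :=
  diagonal (fun i : 'I_(size s) => truncated_map (tnth (in_tuple s) i)).

End Algebra.

Definition dim_seq (s : seq (nat * nat)) : nat := (\sum_(ef <- s) ef.1 * ef.2)%N.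

Definition Lambda (s : seq (nat * nat)) (q : nat) : nat :=
  #|Star (B_map (GF q) s)|.

(* The logarithm of x >= 0 in base b > 1, with value -oo at 0. *)
Definition logb (R : realType) (b x : R) : \bar R :=
  if x == 0 then -oo%E else (ln x / ln b)%:E.

Definition theta (R : realType) (s : seq (nat * nat)) (q : nat) : \bar R :=
  logb q%:R (ln (Lambda s q)%:R / ln 2).

(* liminf and limsup as q -> +oo along the prime powers *)
Definition liminf_pp (R : realType) (u : nat -> \bar R) : \bar R :=
  limf_einf u (within prime_power (\oo)%classic).

Definition limsup_pp (R : realType) (u : nat -> \bar R) : \bar R :=
  limf_esup u (within prime_power (\oo)%classic).

(* Main.v *)
(* Write q = #|k|. Every element of B is a unit times one of finitely many
   monomials w_v, whose number does not depend on q.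

   Upper bound. The non-units of B lie in the proper ideals w_v B, so for large
   q every I in F0 contains a unit u. A star operation is determined by its
   closed sets, and I is closed iff (I : u), which contains 1, is closed. Hence
   log2 Lambda is at most the number of subspaces of B / k = k^(n-1), which is
   O(q^floor((n-1)^2 / 4)).

   Lower bound. Call x good if |ann (x - mu)| <= q for all mu in k; all but
   O(q^(n-1)) elements are good. If x, y are good and b <1, x> is contained in
   <1, y> with b nonzero, then <1, y> is a unit multiple of <1, x>. So, for a
   set D of good elements whose planes <1, x> are pairwise not unit multiples of
   each other, distinct subsets of {<1, x> | x in D} generate distinct star
   operations, and D can be chosen with at least q^(n-4) / 2 elements. *)
Require Import Defs.
From mathcomp Require Import all_boot all_order all_algebra all_field.
From mathcomp Require Import all_classical all_reals all_analysis.

Set Implicit Arguments.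
Unset Strict Implicit.
Unset Printing Implicit Defensive.

From mathcomp Require Import zify lra.

Import Order.TTheory GRing.Theory Num.Theory.
From mathcomp Require Import fintype finset.

Local Open Scope ring_scope.

(** * Finite fields and truncated polynomial rings *)

(** Write q = #|k| and m = q^e. The roots of X^m - X in [L] are distinct and are the fixed points of
    the e-th power of the Frobenius automorphism over [k], so they form a subfield. As they generate
    [L], they exhaust it. *)
Lemma card_splitting_frobenius (k : finFieldType) (e : nat)
    (L : splittingFieldType k) : (0 < e)%N ->
  splittingFieldFor 1 (map_poly (in_alg L) ('X^(#|k| ^ e) - 'X)) {:L} ->
  #|finvect_type L| = (#|k| ^ e)%N.
Proof.
move=> e_gt0; set m := (#|k| ^ e)%N => -[zs].
rewrite rmorphB /= map_polyXn map_polyX => Dq defL.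
have q_gt1 : (1 < #|k|)%N by exact: finNzRing_gt1.
have m_gt1 : (1 < m)%N by rewrite -(expn0 #|k|) ltn_exp2l.
have [p p_pr pcharK] := finPcharP k.
have pcharL : p \in [pchar L] by rewrite pchar_lalg.
have cardk : #|k| = (p ^ logn p #|k|)%N.
  by rewrite {1}(card_pprimeChar pcharK).
have m0 : m%:R = 0 :> L.
  have r_gt0 : (0 < logn p #|k|)%N.
    by case: (logn p _) cardk q_gt1 => // ->.
  by rewrite /m natrX cardk natrX pcharf0 // expr0n gtn_eqF // expr0n gtn_eqF.
(* Since m = 0 in [L], the derivative of X^m - X is -1, so the polynomial is separable. *)
have Uzs : uniq zs.
  rewrite -separable_prod_XsubC -(eqp_separable Dq) unlock.
  rewrite derivB derivXn derivX -mulr_natl -polyC_natr m0 polyC0 mul0r sub0r.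
  by rewrite coprimep_sym -(coprimepZl _ _ (_ : -1 != 0)) ?oppr_eq0 ?oner_eq0 //
     scaleN1r opprK coprime1p.
have sz : size zs = m.
  apply: succn_inj; rewrite -(size_prod_XsubC _ id) -(eqp_size Dq).
  by rewrite size_polyDl size_polyXn // size_polyN size_polyX.
have [a _ Da] := finField_galois_generator (sub1v {:L}%AS).
pose Em := fixedSpace (a ^+ e)%g.
have in_zs : zs =i Em.
  move=> z; rewrite -root_prod_XsubC -(eqp_root Dq) (sameP fixedSpaceP eqP).
  rewrite /root !hornerE subr_eq0 /= /m; congr (_ == z).
  elim: (e) => [|i IHi]; first by rewrite gal_id.
  rewrite expgSr expnSr exprM IHi galM ?memvf // Da ?memvf //.
  by rewrite dimv1 expn1.
have defEm : Em = {:L}%VS.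
  apply/eqP; rewrite eqEsubv subvf -defL -[Em]subfield_closed agenvS //.
  by rewrite subv_add sub1v; apply/span_subvP => z; rewrite in_zs.
have /card_uniqP card_zs : uniq (zs : seq (finvect_type L)) := Uzs.
rewrite -sz -card_zs; apply: eq_card => z.
by rewrite in_zs defEm memvf.
Qed.

Lemma card_finite_ext (k : finFieldType) (e : nat) :
  (0 < e)%N -> #|finite_ext k e| = (#|k| ^ e)%N.
Proof.
move=> e_gt0; rewrite /finite_ext /ext_field.
case: {-}_ / idP => // e_gt0'.
exact: card_splitting_frobenius (svalP (FinSplittingFieldFor _)).
Qed.

Lemma card_GF (q : nat) : prime_power q -> #|GF q| = q.
Proof.
case=> p [m [p_pr m_gt0 ->]]; rewrite /GF.
have -> : pdiv (p ^ m) = p by rewrite -(prednK m_gt0) pdiv_pfactor.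
by rewrite pfactorK // card_finite_ext // card_Fp.
Qed.

Lemma card_truncated (k : finFieldType) (ef : nat * nat) :
  (0 < ef.1)%N -> (0 < ef.2)%N ->
  #|truncated k ef| = (#|k| ^ (ef.1 * ef.2))%N.
Proof.
move=> e_gt0 f_gt0.
rewrite /truncated card_monic_qpoly ?monicXn ?size_polyXn //=.
by rewrite card_finite_ext // expnM.
Qed.

(** Splitting off the largest power of X leaves g with g(0) nonzero; g is coprime to X^f, and a
    Bezout relation inverts it modulo X^f. *)
Lemma qpolyXn_factor (K : finFieldType) (f : nat) (z : {poly %/ ('X^f : {poly K})}) :
  (0 < f)%N -> exists (v : 'I_f.+1) (u u' : {poly %/ ('X^f : {poly K})}),
    u * u' = 1 /\ z = in_qpoly 'X^f 'X^v * u.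
Proof.
case: f z => // f z _; set h := 'X^(f.+1) : {poly K}.
have hM : mk_monic h = h by rewrite mk_monic_Xn.
have sz : (size (z : {poly K}) <= f.+1)%N.
  have szh : size (mk_monic h) = f.+2 by rewrite hM size_polyXn.
  by rewrite -ltnS -szh; exact: size_mk_monic.
have zE : z = in_qpoly h z.
  by apply: val_inj; exact: esym (in_qpoly_small (size_mk_monic z)).
have h0 : in_qpoly h h = 0.
  by apply: val_inj; rewrite /= hM Pdiv.RingMonic.rmodpp ?monicXn.
have [z0|z_neq0] := eqVneq (z : {poly K}) 0.
  (* The zero element is represented by X^f itself, which is why [v] may equal the full exponent. *)
  exists ord_max, 1, 1; rewrite mulr1; split=> //.
  by rewrite zE z0 in_qpoly0 mulr1; exact: esym h0.
have [v [g]] := multiplicity_XsubC (z : {poly K}) 0; rewrite z_neq0 /= subr0.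
move=> g0 zg; have v_lt : (v < f.+2)%N.
  have g_neq0 : g != 0 by apply: contraNneq g0 => ->; rewrite root0.
  by rewrite ltnS; apply: leq_trans sz; rewrite zg size_mulXn // leq_addr.
have : coprimep g h.
  by rewrite coprimep_expr // -(subr0 'X) -polyC0 coprimep_XsubC.
case/Bezout_eq1_coprimepP => -[a b] /= ab.
exists (Ordinal v_lt), (in_qpoly h g), (in_qpoly h a); split=> /=.
  rewrite -in_qpolyM -[RHS]in_qpoly1 -ab mulrC in_qpolyD !in_qpolyM.
  by rewrite h0 mulr0 addr0.
by rewrite -in_qpolyM mulrC -zg.
Qed.

(** * Counting subspaces *)

Lemma leq_card_bigcup (I T : finType) (P : pred I) (F : I -> {set T}) :
  (#|\bigcup_(i | P i) F i| <= \sum_(i | P i) #|F i|)%N.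
Proof.
elim/big_ind2: _ => [|A a B b leA leB|i _]; rewrite ?cards0 //.
by apply: leq_trans (leq_add leA leB); rewrite cardsU leq_subr.
Qed.

(** Adding [Y *m P] changes only the columns selected by [f], turning 1 into 1 + Y there, so the
    pair (A, Y) is recovered from A + Y P. Hence there are at most q^(r (m - r)) normalised
    matrices. *)
Lemma card_colsub1 (k : finFieldType) (m r : nat) (f : 'I_r -> 'I_m) :
  injective f ->
  (#|[set A : 'M[k]_(r, m) | colsub f A == 1%:M]| * #|k| ^ (r * r)
     <= #|k| ^ (r * m))%N.
Proof.
move=> f_inj; set E := [set A | _].
pose P : 'M[k]_(r, m) := \matrix_(i, j) (j == f i)%:R.
have fP : colsub f P = 1%:M.
  by apply/matrixP => i j; rewrite !mxE (inj_eq f_inj) eq_sym.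
pose F (AY : 'M[k]_(r, m) * 'M[k]_r) := AY.1 + AY.2 *m P.
rewrite -!card_mx -cardsT -cardsX -(card_in_imset (f := F)) ?max_card //.
move=> [A Y] [A' Y'] /[!inE] /andP[/= /eqP fA _] /andP[/eqP fA' _] eqF.
have eqY : Y = Y'.
  have colF B Z : colsub f B = 1%:M -> colsub f (F (B, Z)) = 1%:M + Z.
    have -> : colsub f (F (B, Z)) = colsub f B + Z *m colsub f P.
      apply/matrixP => i j; rewrite !mxE; congr (_ + _).
      by apply: eq_bigr => l _; rewrite !mxE.
    by rewrite fP mulmx1 => ->.
  by apply: (addrI 1%:M); rewrite -(colF A) // eqF colF.
by move: eqF; rewrite /F /= eqY => /addIr ->.
Qed.

Definition is_mxspace (k : finFieldType) (m : nat) (W : {set 'rV[k]_m}) : bool :=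
  [&& 0 \in W, [forall x in W, forall y in W, x + y \in W] &
      [forall a : k, forall x in W, a *: x \in W]].

(* Normalising a maximal minor of a basis to the identity leaves only
   r (m - r) free entries. *)
Lemma mxspace_normal_form (k : finFieldType) (m : nat) (W : {set 'rV[k]_m}) :
  is_mxspace W -> exists (r : 'I_m.+1) (f : {ffun 'I_r -> 'I_m}) (A : 'M[k]_(r, m)),
    [/\ injective f, colsub f A = 1%:M & W = [set x | (x <= A)%MS]].
Proof.
case/and3P => W0 /'forall_in_'forall_in_idP WD /forallP WZ.
pose M := \matrix_(i < #|W|) enum_val i.
have WE x : (x \in W) = (x <= M)%MS.
  apply/idP/idP => [Wx|/submxP[c ->]].
    by rewrite (eq_row_sub (enum_rank_in Wx x)) // rowK enum_rankK_in.
  rewrite mulmx_sum_row; elim/big_ind: _ => // [y z Wy Wz|i _].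
    exact: WD.
  by have /'forall_in_idP := WZ (c 0 i); apply; rewrite rowK enum_valP.
have r_lt : (\rank M < m.+1)%N by rewrite ltnS rank_leq_col.
exists (Ordinal r_lt) => /=; set B := row_base M.
have Bt_full : row_full B^T.
  by rewrite /row_full mxrank_tr; exact: row_base_free.
pose f := fullrankfun Bt_full; pose C := colsub f B.
have C_unit : C \in unitmx.
  by rewrite -unitmx_tr trmx_mxsub; apply: fullrowsub_unit.
exists f, (invmx C *m B); split; first exact: fullrankfun_inj.
  rewrite -(mulVmx C_unit) /C; apply/matrixP => i j.
  by rewrite !mxE; apply: eq_bigr => l _; rewrite !mxE.
apply/setP => x; rewrite inE WE -(eq_row_base M) -/B.
by rewrite (eqmxMfull B (_ : row_full (invmx C))) // row_full_unit unitmx_inv.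
Qed.

Lemma muln_sub_le_quarter (m r : nat) :
  (r <= m)%N -> (r * (m - r) <= (m * m) %/ 4)%N.
Proof.
move=> le_rm; rewrite leq_divRL // -{2 3}(subnKC le_rm) mulnC.
exact: nat_AGM2.
Qed.

(** In dimension r there are at most m^r choices of the pivot columns [f], and each leaves r (m - r)
    <= m^2 / 4 free entries. *)
Lemma card_mxspace_le (k : finFieldType) (m : nat) :
  (#|[set W : {set 'rV[k]_m} | is_mxspace W]|
     <= (\sum_(r < m.+1) m ^ r) * #|k| ^ ((m * m) %/ 4))%N.
Proof.
have q_gt0 : (0 < #|k|)%N by apply/card_gt0P; exists 0.
pose E r (f : {ffun 'I_r -> 'I_m}) : {set 'M[k]_(r, m)} :=
  [set A | colsub f A == 1%:M].
pose S r (f : {ffun 'I_r -> 'I_m}) : {set {set 'rV[k]_m}} :=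
  if injectiveb f then [set [set x | (x <= A)%MS] | A in E r f] else set0.
have cardS (r : 'I_m.+1) f : (#|S r f| <= #|k| ^ ((m * m) %/ 4))%N.
  rewrite /S; case: injectiveP => [f_inj|_]; last by rewrite cards0.
  apply: leq_trans (leq_imset_card _ _) _.
  have le_rm : (r <= m)%N by rewrite -ltnS.
  apply: (@leq_trans (#|k| ^ (r * (m - r)))); last first.
    by rewrite leq_pexp2l ?muln_sub_le_quarter.
  rewrite -(@leq_pmul2r (#|k| ^ (r * r))) ?expn_gt0 ?q_gt0 //.
  by rewrite -expnD -mulnDr subnK // card_colsub1.
have sub : [set W | is_mxspace W] \subset
    \bigcup_(r < m.+1) \bigcup_(f : {ffun 'I_r -> 'I_m}) S r f.
  apply/subsetP => W /[!inE] /mxspace_normal_form[r [f [A [f_inj fA ->]]]].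
  apply/bigcupP; exists r => //; apply/bigcupP; exists f => //.
  by rewrite /S (introT (injectiveP _) f_inj) imset_f // inE fA.
apply: leq_trans (subset_leq_card sub) _.
apply: leq_trans (leq_card_bigcup _ _) _.
rewrite big_distrl /=; apply: leq_sum => r _.
apply: leq_trans (leq_card_bigcup _ _) _.
apply: (@leq_trans (\sum_(f : {ffun 'I_r -> 'I_m}) #|k| ^ ((m * m) %/ 4))).
  by apply: leq_sum => f _; exact: cardS.
by rewrite sum_nat_const card_ffun !card_ord.
Qed.

(** * Subspaces of a finite algebra *)

Section Subspaces.

Variables (k : finFieldType) (B : finComPzRingType) (iota : {rmorphism k -> B}).

Implicit Types (I J : {set B}) (b u w x y z : B).

Lemma is_subspaceP I :
  reflect [/\ 0 \in I, forall x y, x \in I -> y \in I -> x + y \in I &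
              forall a x, x \in I -> iota a * x \in I]
          (is_subspace iota I).
Proof.
apply: (iffP and3P) => -[I0 ID IZ]; split=> //.
- by move=> x y Ix Iy; move/'forall_implyP/(_ x Ix)/'forall_implyP/(_ y Iy): ID.
- by move=> a x Ix; move/forallP/(_ a)/'forall_implyP/(_ x Ix): IZ.
- by apply/'forall_implyP => x Ix; apply/'forall_implyP => y; apply: ID.
- by apply/forallP => a; apply/'forall_implyP => x; apply: IZ.
Qed.

Lemma subspaceB I x y :
  is_subspace iota I -> x \in I -> y \in I -> x - y \in I.
Proof.
case/is_subspaceP => _ ID IZ Ix Iy; apply: ID => //.
by rewrite -mulN1r -(rmorph1 iota) -rmorphN; apply: IZ.
Qed.

Lemma subspace0 : is_subspace iota [set 0].
Proof.
apply/is_subspaceP; split=> [|x y|a x]; rewrite !inE //.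
  by move=> /eqP-> /eqP->; rewrite addr0.
by move=> /eqP->; rewrite mulr0.
Qed.

Lemma subspaceI I J :
  is_subspace iota I -> is_subspace iota J -> is_subspace iota (I :&: J).
Proof.
move=> /is_subspaceP[I0 ID IZ] /is_subspaceP[J0 JD JZ].
apply/is_subspaceP; split=> [|x y|a x]; rewrite !inE ?I0 //.
  by move=> /andP[Ix Jx] /andP[Iy Jy]; rewrite ID ?JD.
by move=> /andP[Ix Jx]; rewrite IZ ?JZ.
Qed.

Lemma subspace_residual I b :
  is_subspace iota I -> is_subspace iota (residual I b).
Proof.
move=> /is_subspaceP[I0 ID IZ]; apply/is_subspaceP; split=> [|x y|a x].
- by rewrite inE mulr0.
- by rewrite !inE mulrDr; apply: ID.
- by rewrite !inE mulrCA; apply: IZ.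
Qed.

Definition principal w : {set B} := [set w * x | x : B].

Definition annihilator w : {set B} := residual [set 0] w.

Lemma subspace_principal w : is_subspace iota (principal w).
Proof.
apply/is_subspaceP; split=> [|x y|a x].
- by apply/imsetP; exists 0; rewrite ?mulr0.
- by case/imsetP => x' _ -> /imsetP[y' _ ->]; rewrite -mulrDr imset_f.
- by case/imsetP => x' _ ->; rewrite mulrCA imset_f.
Qed.

(** Each nonempty fibre of multiplication by [w] is a coset of the annihilator. *)
Lemma card_principal_annihilator w :
  (#|principal w| * #|annihilator w| = #|B|)%N.
Proof.
rewrite -[RHS]cardsT -[RHS]sum1_card.
rewrite (partition_big (fun x => w * x) (mem (principal w))) /=; last first.
  by move=> x _; apply: imset_f.
rewrite -sum_nat_const; apply: eq_bigr => _ /imsetP[x0 _ ->].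
rewrite -(card_imset _ (addIr x0)) -sum1_card; apply: eq_bigl => x.
rewrite !inE; apply/imsetP/eqP => [[y + ->]|eqx].
  by rewrite !inE mulrDr => /eqP->; rewrite add0r.
by exists (x - x0); rewrite ?subrK // !inE mulrBr eqx subrr.
Qed.

(** The sums c y + x, with c in k and x in J, are pairwise distinct because y lies outside J: a
    proper subspace is smaller by a factor of at least q. *)
Lemma card_subspace_lt I J y :
  is_subspace iota I -> is_subspace iota J -> J \subset I ->
  y \in I -> y \notin J -> (#|k| * #|J| <= #|I|)%N.
Proof.
move=> /is_subspaceP[_ ID IZ] subJ /subsetP sJI Iy Jy.
have [_ JD JZ] := is_subspaceP _ subJ.
pose F (cx : k * B) := iota cx.1 * y + cx.2.
rewrite -cardsT -cardsX -(card_in_imset (f := F)).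
  apply/subset_leq_card/subsetP => _ /imsetP[[c x] /[!inE] /= Jx ->].
  by apply: ID; [apply: IZ | apply: sJI].
move=> [c x] [c' x'] /[!inE] /= Jx Jx'; rewrite /F /= => eqF.
have eqD : iota (c - c') * y = x' - x.
  have -> : x' = iota c * y + x - iota c' * y by rewrite eqF addrAC subrr add0r.
  by rewrite rmorphB mulrBl [RHS]addrAC addrK.
have [eqc|neqc] := eqVneq c c'.
  by move: eqF; rewrite eqc => /addrI->.
case/negP: Jy; rewrite -[y]mul1r -(rmorph1 iota) -(mulVf (_ : c - c' != 0)).
  by rewrite rmorphM -mulrA; apply: JZ; rewrite eqD; apply: subspaceB.
by rewrite subr_eq0.
Qed.

Definition line b : {set B} := [set iota a * b | a : k].

Lemma subspace_line b : is_subspace iota (line b).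
Proof.
apply/is_subspaceP; split=> [|x y|a x].
- by apply/imsetP; exists 0; rewrite ?rmorph0 ?mul0r.
- case/imsetP => a _ -> /imsetP[c _ ->].
  by apply/imsetP; exists (a + c); rewrite // rmorphD mulrDl.
- case/imsetP => c _ ->.
  by apply/imsetP; exists (a * c); rewrite // rmorphM mulrA.
Qed.

Lemma mem_line b : b \in line b.
Proof. by apply/imsetP; exists 1; rewrite // rmorph1 mul1r. Qed.

Lemma line_sub I b : is_subspace iota I -> b \in I -> line b \subset I.
Proof.
case/is_subspaceP => _ _ IZ Ib.
by apply/subsetP => _ /imsetP[a _ ->]; apply: IZ.
Qed.

Lemma card_line_le b : (#|line b| <= #|k|)%N.
Proof. exact: leq_imset_card. Qed.

Lemma card_line b : b != 0 -> #|line b| = #|k|.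
Proof.
move=> b0; apply/eqP; rewrite eqn_leq card_line_le -[leqLHS]muln1 -(cards1 (0 : B)).
apply: (card_subspace_lt (subspace_line b) subspace0 _ (mem_line b)).
  by rewrite sub1set; case/is_subspaceP: (subspace_line b).
by rewrite inE.
Qed.

Lemma card_subspace_sqr I :
  is_subspace iota I -> (#|k| < #|I|)%N -> (#|k| ^ 2 <= #|I|)%N.
Proof.
move=> subI ltI; have [I0 _ _] := is_subspaceP _ subI.
have /subsetPn[b Ib b0] : ~~ (I \subset [set 0]).
  apply: contraL ltI => /subset_leq_card; rewrite cards1 -leqNgt => leI.
  by apply: leq_trans leI _; apply/card_gt0P; exists 0.
rewrite inE in b0.
have /subsetPn[c Ic bc] : ~~ (I \subset line b).
  by apply: contraL ltI => /subset_leq_card; rewrite card_line // -leqNgt.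
have := card_subspace_lt subI (subspace_line b) (line_sub subI Ib) Ic bc.
by rewrite card_line.
Qed.

Lemma extension_mono I J : I \subset J -> extension I \subset extension J.
Proof.
move=> sIJ; apply/subsetP => y; rewrite !inE => /existsP[c /eqP->].
apply/existsP; exists [ffun x => if x \in I then c x else 0]; apply/eqP.
rewrite [RHS](big_setID I) /= (setIidPr sIJ) [X in _ + X]big1 ?addr0.
  by apply: eq_bigr => x Ix; rewrite ffunE Ix.
by move=> x /[!inE] /andP[/negPf xI _]; rewrite ffunE xI mulr0.
Qed.

Lemma F0_sup I J : I \in F0 iota -> I \subset J -> is_subspace iota J -> J \in F0 iota.
Proof.
rewrite !inE => /andP[_ /eqP extI] sIJ -> /=.
by rewrite eqEsubset subsetT -extI extension_mono.
Qed.

Lemma F0_unit I u u' :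
  is_subspace iota I -> u * u' = 1 -> u \in I -> I \in F0 iota.
Proof.
move=> subI uu' Iu; rewrite inE subI /=; apply/eqP/setP => y; rewrite !inE.
apply/existsP; exists [ffun x => if x == u then u' * y else 0].
rewrite (bigD1 u) //= ffunE eqxx mulrA uu' mul1r big1 ?addr0 //.
by move=> x /andP[_ /negPf xu]; rewrite ffunE xu mulr0.
Qed.

(** I B = B forces 1 into the ideal w B. *)
Lemma F0_not_principal I w :
  I \in F0 iota -> I \subset principal w -> exists w', w * w' = 1.
Proof.
rewrite inE => /andP[_ /eqP extI] sIw.
have : 1 \in extension I by rewrite extI inE.
rewrite inE => /existsP[c /eqP eq1].
suff /imsetP[w' _ ->] : 1 \in principal w by exists w'.
rewrite eq1; have /is_subspaceP[w0 wD _] := subspace_principal w.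
elim/big_ind: _ => // x /(subsetP sIw)/imsetP[x' _ ->].
by rewrite -mulrA imset_f.
Qed.

End Subspaces.

(** * Star operations: upper bound *)

Section UpperBound.

Variables (k : finFieldType) (B : finComPzRingType) (iota : {rmorphism k -> B}).

(** Induction on [r] extends 1 to r independent elements: the next element [b] exists because the
    span so far has fewer than q^n elements. For r = n, counting makes the injection onto, so [phi]
    identifies k^(n-1) with a complement of k in B. *)
Lemma linear_complement_of_1 (n r : nat) :
  (0 < r)%N -> (r <= n)%N -> #|B| = (#|k| ^ n)%N ->
  exists phi : 'rV[k]_r.-1 -> B,
    [/\ forall x y, phi (x + y) = phi x + phi y,
        forall a x, phi (a *: x) = iota a * phi x &
        injective (fun ax : k * 'rV[k]_r.-1 => iota ax.1 + phi ax.2)].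
Proof.
move=> r_gt0 le_rn cardB; have q_gt1 := finNzRing_gt1 k.
have B1 : 1 != 0 :> B.
  apply/eqP => B10; have : (#|B| <= 1)%N.
    apply/card_le1P => x _ y; rewrite !inE.
    by rewrite -[y]mulr1 -[x]mulr1 B10 !mulr0 eqxx.
  by rewrite cardB leqNgt -(expn0 #|k|) ltn_exp2l // (leq_trans r_gt0).
have iota_eq0 a : iota a = 0 -> a = 0.
  move=> a0; apply/eqP; apply: contraNT B1 => a_neq0.
  by rewrite -(rmorph1 iota) -(mulVf a_neq0) rmorphM a0 mulr0.
elim: r => // -[_|r IHr] in r_gt0 le_rn *.
  exists (fun=> 0); split=> [x y|a x|]; rewrite ?addr0 ?mulr0 //.
  move=> [a x] [b y] /=; rewrite !addr0 => /eqP; rewrite -subr_eq0 -rmorphB.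
  move=> /eqP/iota_eq0/eqP; rewrite subr_eq0 => /eqP->.
  by congr (_, _); apply/rowP => -[].
have [phi [phiD phiZ phi_inj]] := IHr isT (ltnW le_rn).
rewrite [r.+1.-1]/= in phi phiD phiZ phi_inj *; rewrite [r.+2.-1]/=.
pose F (ax : k * 'rV[k]_r) := iota ax.1 + phi ax.2.
have [b bF] : exists b, b \notin codom F.
  apply/existsP; apply: contraTT le_rn; rewrite negb_exists => /forallP allF.
  rewrite -ltnNge ltnS -(leq_exp2l _ _ q_gt1) -cardB.
  have -> : (#|k| ^ r.+1 = #|{: k * 'rV[k]_r}|)%N.
    by rewrite card_prod card_mx mul1n expnS.
  rewrite -(card_codom phi_inj) subset_leq_card //.
  by apply/subsetP => x _; have := allF x; rewrite negbK.
(* Coordinate 0 carries the new element [b]; the remaining ones go through the old [phi]. *)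
pose psi (x : 'rV[k]_r.+1) := iota (x 0 0) * b + phi (col' 0 x).
have FD u v : F (u + v) = F u + F v.
  by rewrite /F /= rmorphD phiD addrACA.
have FZ a u : F (a * u.1, a *: u.2) = iota a * F u.
  by rewrite /F /= rmorphM phiZ mulrDr.
exists psi; split=> [x y|a x|].
- rewrite /psi mxE rmorphD mulrDl.
  have -> : col' 0 (x + y) = col' 0 x + col' 0 y.
    by apply/matrixP => i j; rewrite !mxE.
  by rewrite phiD addrACA.
- rewrite /psi mxE rmorphM.
  have -> : col' 0 (a *: x) = a *: col' 0 x by apply/matrixP => i j; rewrite !mxE.
  by rewrite phiZ mulrDr mulrA.
move=> [a x] [a' x'] /= eqpsi.
have eqF : iota (x 0 0 - x' 0 0) * b = F (a' - a, col' 0 x' - col' 0 x).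
  have phiB y y' : phi (y' - y) = phi y' - phi y.
    by apply: (addIr (phi y)); rewrite -phiD !subrK.
  have rearrange (p p' s s' t t' : B) :
      p + (s + t) = p' + (s' + t') -> s - s' = (p' - p) + (t' - t).
    move=> eq1; have -> : s = p' + (s' + t') - p - t.
      by rewrite -eq1 [p + _]addrC !addrK.
    rewrite [RHS]addrACA (addrC s') (addrA p') (addrAC _ s') (addrAC _ s') addrK.
    by rewrite -[LHS]addrA.
  by rewrite /F /= phiB !rmorphB mulrBl; apply: rearrange.
(* If the coefficients of [b] differed, dividing [eqF] by their difference would put [b] in the
   image of [F]. *)
have eq0 : x 0 0 = x' 0 0.
  apply/eqP; rewrite -subr_eq0; apply: contraNT bF => c0.
  apply/codomP; exists ((x 0 0 - x' 0 0)^-1 * (a' - a),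
                        (x 0 0 - x' 0 0)^-1 *: (col' 0 x' - col' 0 x)).
  rewrite (FZ _ (a' - a, col' 0 x' - col' 0 x)) -eqF mulrA -rmorphM.
  by rewrite mulVf // rmorph1 mul1r.
have [-> eqx] : (a, col' 0 x) = (a', col' 0 x').
  apply: phi_inj => /=; apply: (addrI (iota (x 0 0) * b)).
  by rewrite addrCA {2}eq0 [RHS]addrCA.
congr (_, _); apply/rowP => j; case: (unliftP 0 j) => [j' ->|->] //.
by move/rowP/(_ j'): eqx; rewrite !mxE.
Qed.

(** A subspace containing 1 contains k, so it is determined by its preimage under [phi], a subspace
    of k^(n-1). *)
Lemma card_subspaces1_le (n : nat) :
  (0 < n)%N -> #|B| = (#|k| ^ n)%N ->
  (#|[set I : {set B} | is_subspace iota I && (1%R \in I)]|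
     <= (\sum_(r < n) n.-1 ^ r) * #|k| ^ ((n.-1 * n.-1) %/ 4))%N.
Proof.
move=> n_gt0 cardB.
have [phi [phiD phiZ phi_inj]] := linear_complement_of_1 n_gt0 (leqnn n) cardB.
pose pre (I : {set B}) := [set x | phi x \in I].
have decomp b : exists a x, b = iota a + phi x.
  suff /codomP[[a x] ->] : b \in codom (fun ax => iota ax.1 + phi ax.2) by exists a, x.
  have eq_card : #|codom (fun ax => iota ax.1 + phi ax.2)| = #|B|.
    rewrite (card_codom phi_inj) card_prod card_mx mul1n cardB -expnS.
    by rewrite prednK.
  by rewrite (elimT (subset_cardP eq_card) _) ?inE //; apply/subsetP.
rewrite -(card_in_imset (f := pre)); last first.
  move=> I J /[!inE] /andP[/is_subspaceP[_ ID IZ] I1] /andP[subJ J1] eqIJ.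
  have mem_pre (K : {set B}) a x : is_subspace iota K -> 1 \in K ->
      (iota a + phi x \in K) = (x \in pre K).
    move=> subK K1; rewrite inE; have /is_subspaceP[_ KD KZ] := subK.
    have Ka : iota a \in K by rewrite -[iota a]mulr1 KZ.
    apply/idP/idP => [Kx|]; last exact: KD.
    by rewrite -[phi x](addKr (iota a)) addrC; apply: (subspaceB subK).
  apply/setP => b; have [a [x ->]] := decomp b.
  rewrite !mem_pre ?eqIJ //; apply/is_subspaceP; split=> //.
  by rewrite -(mul0r 1) -(rmorph0 iota) IZ.
have := card_mxspace_le k n.-1; rewrite prednK //; apply: leq_trans.
apply/subset_leq_card/subsetP => _ /imsetP[I + ->].
rewrite !inE => /andP[/is_subspaceP[I0 ID IZ] _].
have phi0 : phi 0 = 0 by rewrite -[0 in LHS](scale0r 0) phiZ rmorph0 mul0r.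
apply/and3P; split; first by rewrite inE phi0.
  apply/'forall_implyP => x /[!inE] Ix; apply/'forall_implyP => y /[!inE] Iy.
  by rewrite phiD ID.
by apply/forallP => a; apply/'forall_implyP => x /[!inE] Ix; rewrite phiZ IZ.
Qed.

Lemma StarP (star : {ffun F0_type iota -> F0_type iota}) :
  reflect [/\ forall I : F0_type iota, val I \subset val (star I),
              forall I J : F0_type iota, val I \subset val J ->
                val (star I) \subset val (star J),
              forall I : F0_type iota, star (star I) = star I,
              forall (I J : F0_type iota) b, val J = residual (val I) b ->
                val (star J) \subset residual (val (star I)) b &
              star (baseF0 iota) = baseF0 iota]
          (star \in Star iota).
Proof.
rewrite inE; apply: (iffP andP) => [[/andP[/and3P[sup mono idem] mult] /eqP base0]|].
  split=> // [I|I J|I|I J b eqJ].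
  - exact: (forallP sup).
  - by move/forallP/(_ I)/'forall_implyP/(_ J): mono.
  - exact/eqP/(forallP idem).
  - have /forallP/(_ I)/forallP/(_ b)/'forall_implyP/(_ J) := mult.
    by rewrite eqJ; apply.
case=> sup mono idem mult base0; rewrite base0 eqxx; split=> //.
apply/andP; split; last first.
  apply/forallP => I; apply/forallP => b; apply/'forall_implyP => J /eqP.
  exact: mult.
apply/and3P; split; first exact/forallP.
  by apply/forallP => I; apply/'forall_implyP => J; apply: mono.
by apply/forallP => I; rewrite idem.
Qed.

Variables (star : {ffun F0_type iota -> F0_type iota}).
Hypothesis starP : star \in Star iota.

(** The closure of (I : b) lies in (I^* : b) = (I : b), so closedness passes to residuals. *)
Lemma star_fix_residual (I J : F0_type iota) (b : B) :
  star I = I -> val J = residual (val I) b -> star J = J.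
Proof.
have [sup _ _ mult _] := StarP _ starP.
move=> fixI eqJ; apply/val_inj/eqP; rewrite eqEsubset sup andbT.
by rewrite eqJ -[in residual _ _]fixI; apply: mult.
Qed.

End UpperBound.

(** * Determining a star operation by its closed subspaces that contain 1 *)

Section Star.

Variables (k : finFieldType) (B : finComPzRingType) (iota : {rmorphism k -> B}).

(** [star I] contains I and is closed for [star'] as well, so it contains [star' I]. Applied in both
    directions, this shows that the closed subspaces determine the operation. *)
Lemma star_sub_of_fix (star star' : {ffun F0_type iota -> F0_type iota}) :
  star \in Star iota -> star' \in Star iota ->
  (forall I : F0_type iota, star I = I -> star' I = I) ->
  forall I : F0_type iota, val (star' I) \subset val (star I).
Proof.
move=> /StarP[sup _ idem _ _] /StarP[_ mono' _ _ _] fix_fix I.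
by rewrite -(fix_fix (star I)) // mono'.
Qed.

Variables (T : finType) (w : T -> B).
Hypothesis associates : forall z, exists j u u', u * u' = 1 /\ z = w j * u.

(** Without units, I is covered by its intersections with the proper ideals among the w_j B. No such
    ideal contains I, so each intersection has at most |I| / q elements, and fewer than q of them
    cannot cover I. *)
Lemma F0_has_unit (I : {set B}) : (#|T| < #|k|)%N -> I \in F0 iota ->
  exists u u', u \in I /\ u * u' = 1.
Proof.
move=> ltTk F0I; have subI : is_subspace iota I by move: F0I; rewrite inE => /andP[].
have [/existsP[u /existsP[u' /andP[Iu /eqP uu']]]|] :=
  boolP [exists u, exists u', (u \in I) && (u * u' == 1)]; first by exists u, u'.
move=> noU; pose P j := [forall u, w j * u != 1].
have sub : I \subset \bigcup_(j | P j) (I :&: principal (w j)).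
  apply/subsetP => z Iz; have [j [u [u' [uu' eqz]]]] := associates z.
  apply/bigcupP; exists j; last by rewrite inE Iz eqz imset_f.
  apply/forallP => v; apply: contra noU => /eqP wv.
  apply/existsP; exists z; apply/existsP; exists (u' * v); rewrite Iz eqz /=.
  by rewrite -mulrA (mulrA u) uu' mul1r wv.
have card_lt j : P j -> (#|k| * #|I :&: principal (w j)| <= #|I|)%N.
  move=> /forallP Pj; have /subsetPn[y Iy wy] : ~~ (I \subset principal (w j)).
    by apply/negP => /(F0_not_principal F0I)[w' ww']; have := Pj w'; rewrite ww' eqxx.
  apply: (card_subspace_lt subI _ (subsetIl _ _) Iy).
    exact: subspaceI (subspace_principal _ _).
  by rewrite inE Iy.
have I_gt0 : (0 < #|I|)%N.
  by apply/card_gt0P; exists 0; case/is_subspaceP: subI.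
suff : (#|k| * #|I| <= #|T| * #|I|)%N by rewrite leq_pmul2r // leqNgt ltTk.
apply: leq_trans (leq_mul (leqnn _) (subset_leq_card sub)) _.
apply: leq_trans (leq_mul (leqnn _) (leq_card_bigcup _ _)) _.
rewrite big_distrr /= -sum_nat_const big_mkcond /=.
by apply: leq_sum => j _; case: ifP => // /card_lt.
Qed.

Lemma card_Star_le : (#|T| < #|k|)%N ->
  (#|Star iota| <= 2 ^ #|[set I | is_subspace iota I && (1%R \in I)]|)%N.
Proof.
move=> ltTk; set S := [set I | _]; rewrite -card_powerset.
(* The invariant of [star]: its closed subspaces that contain 1. *)
pose C (star : {ffun F0_type iota -> F0_type iota}) : {set {set B}} :=
  [set I in S | [exists F : F0_type iota, (val F == I) && (star F == F)]].
have fixC star star' : star \in Star iota -> star' \in Star iota ->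
    C star = C star' -> forall I : F0_type iota, star I = I -> star' I = I.
  move=> St St' eqC I fixI; have F0I := valP I.
  have subI : is_subspace iota (val I) by move: F0I; rewrite inE => /andP[].
  have [u [u' [Iu uu']]] := F0_has_unit ltTk F0I.
  pose J := residual (val I) u.
  have J1 : 1 \in J by rewrite inE mulr1.
  have subJ : is_subspace iota J by exact: subspace_residual.
  have F0J : J \in F0 iota by apply: (F0_unit subJ (mul1r 1)).
  pose FJ : F0_type iota := exist _ J F0J.
  have : J \in C star.
    rewrite !inE subJ mulr1 Iu; apply/existsP; exists FJ; rewrite eqxx /=.
    by apply/eqP/(star_fix_residual St fixI).
  rewrite eqC inE => /andP[_ /existsP[F /andP[/eqP valF /eqP fixF]]].
  (* The inverse [u'] undoes the normalisation: I = (J : u'). *)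
  apply: (star_fix_residual (b := u') St' fixF); rewrite valF.
  by apply/setP => x; rewrite !inE mulrA uu' mul1r.
rewrite -(card_in_imset (f := C)) => [|star star' St St' eqC].
  apply/subset_leq_card/subsetP => _ /imsetP[star _ ->]; rewrite inE.
  by apply/subsetP => I /[!inE] /andP[].
apply/ffunP => I; apply/val_inj/eqP; rewrite eqEsubset.
by rewrite !star_sub_of_fix //; apply: fixC.
Qed.

End Star.

(** * Star operations: lower bound *)

Section GeneratedStar.

Variables (k : finFieldType) (B : finComPzRingType) (iota : {rmorphism k -> B}).
Variable E : {set {set B}}.

(** A generalised divisorial closure: for [E] = {k} this is (k : (k : I)). *)
Definition residual_closure (I : {set B}) : {set B} :=
  [set x | [forall L in E, forall b,
              (I \subset residual L b) ==> (x \in residual L b)]].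

Lemma mem_residual_closure (I : {set B}) x :
  reflect (forall L b, L \in E -> I \subset residual L b -> b * x \in L)
          (x \in residual_closure I).
Proof.
rewrite inE; apply: (iffP forall_inP) => H => [L b EL sub|L EL].
  by have /forallP/(_ b)/implyP/(_ sub) := H L EL; rewrite inE.
by apply/forallP => b; apply/implyP => sub; rewrite inE; apply: H.
Qed.

Lemma sub_residual_closure (I : {set B}) : I \subset residual_closure I.
Proof.
apply/subsetP => x Ix; apply/mem_residual_closure => L b _ /subsetP/(_ x Ix).
by rewrite inE.
Qed.

Hypothesis subE : forall L, L \in E -> is_subspace iota L.

Lemma subspace_residual_closure (I : {set B}) :
  is_subspace iota (residual_closure I).
Proof.
apply/is_subspaceP; split=> [|x y /mem_residual_closure clx /mem_residual_closure cly|
    a x /mem_residual_closure clx]; apply/mem_residual_closure => L b EL sub;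
  have /is_subspaceP[L0 LD LZ] := subE EL.
- by rewrite mulr0.
- by rewrite mulrDr LD ?clx ?cly.
- by rewrite mulrCA LZ ?clx.
Qed.

Lemma residual_closure_F0 (I : F0_type iota) :
  residual_closure (val I) \in F0 iota.
Proof.
exact: F0_sup (valP I) (sub_residual_closure _) (subspace_residual_closure _).
Qed.

Definition generated_star : {ffun F0_type iota -> F0_type iota} :=
  [ffun I => exist _ (residual_closure (val I)) (residual_closure_F0 I)].

Lemma generated_star_fix (I : F0_type iota) :
  val I \in E -> generated_star I = I.
Proof.
move=> EI; apply/val_inj/eqP; rewrite ffunE /= eqEsubset sub_residual_closure andbT.
apply/subsetP => x /mem_residual_closure/(_ _ 1 EI); rewrite mul1r; apply.
by apply/subsetP => y Iy; rewrite inE mul1r.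
Qed.

Lemma generated_star_in : base iota \in E -> generated_star \in Star iota.
Proof.
move=> Ebase; apply/StarP; split.
- by move=> I; rewrite ffunE sub_residual_closure.
- move=> I J sIJ; rewrite !ffunE /=; apply/subsetP => x /mem_residual_closure clx.
  apply/mem_residual_closure => L b EL sJL; apply: clx => //.
  exact: subset_trans sIJ sJL.
- move=> I; apply/val_inj/eqP; rewrite !ffunE /= eqEsubset sub_residual_closure andbT.
  apply/subsetP => x /mem_residual_closure clx.
  apply/mem_residual_closure => L b EL sIL; apply: clx => //.
  by apply/subsetP => y /mem_residual_closure/(_ L b EL sIL); rewrite inE.
- move=> I J b eqJ; rewrite !ffunE /= eqJ; apply/subsetP => x /mem_residual_closure clx.
  rewrite inE; apply/mem_residual_closure => L c EL /subsetP sIL.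
  (* If I lies in (L : c), then (I : b) lies in (L : c b). *)
  rewrite mulrA; apply: clx => //; apply/subsetP => y /[!inE] Iby.
  by have := sIL _ Iby; rewrite inE mulrA.
- exact: generated_star_fix.
Qed.

End GeneratedStar.

(** * Good elements x and their planes <1, x> *)

Section LowerBound.

Variables (k : finFieldType) (B : finComPzRingType) (iota : {rmorphism k -> B}).
Variables (T : finType) (w : T -> B) (n : nat).
Hypothesis associates : forall z, exists j u u', u * u' = 1 /\ z = w j * u.
Hypothesis card_B : #|B| = (#|k| ^ n)%N.
Hypothesis n_ge3 : (3 <= n)%N.

Let q_gt1 : (1 < #|k|)%N := finNzRing_gt1 k.
Let q_gt0 : (0 < #|k|)%N := ltnW q_gt1.

Let exp_gt (r : nat) : (r < 3)%N -> (#|k| ^ r < #|B|)%N.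
Proof. by move=> r3; rewrite card_B ltn_exp2l // (leq_trans r3). Qed.

Let iota_inv a : a != 0 -> iota a * iota a^-1 = 1.
Proof. by move=> a0; rewrite -rmorphM mulfV // rmorph1. Qed.

Let iota_Vinv a : a != 0 -> iota a^-1 * iota a = 1.
Proof. by move=> a0; rewrite mulrC iota_inv. Qed.

Definition plane (x : B) : {set B} :=
  [set iota ac.1 + iota ac.2 * x | ac : k * k].

Lemma planeP x z :
  reflect (exists a c, z = iota a + iota c * x) (z \in plane x).
Proof.
apply: (iffP imsetP) => [[[a c] _ ->]|[a [c ->]]]; first by exists a, c.
by exists (a, c).
Qed.

Lemma plane1 x : 1 \in plane x.
Proof. by apply/planeP; exists 1, 0; rewrite rmorph0 rmorph1 mul0r addr0. Qed.

Lemma plane_gen x : x \in plane x.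
Proof. by apply/planeP; exists 0, 1; rewrite rmorph0 rmorph1 mul1r add0r. Qed.

Lemma card_plane_le x : (#|plane x| <= #|k| ^ 2)%N.
Proof. by rewrite -mulnn -card_prod; apply: leq_imset_card. Qed.

Lemma subspace_plane x : is_subspace iota (plane x).
Proof.
apply/is_subspaceP; split=> [|y z|a y].
- by apply/planeP; exists 0, 0; rewrite rmorph0 mul0r addr0.
- case/planeP => a [c ->] /planeP[a' [c' ->]]; apply/planeP.
  by exists (a + a'), (c + c'); rewrite !rmorphD mulrDl addrACA.
- case/planeP => b [c ->]; apply/planeP; exists (a * b), (a * c).
  by rewrite !rmorphM mulrDr mulrA.
Qed.

Lemma plane_F0 x : plane x \in F0 iota.
Proof. exact: F0_unit (subspace_plane x) (mul1r 1) (plane1 x). Qed.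

Definition planeF0 x : F0_type iota := exist _ (plane x) (plane_F0 x).

(** Annihilators are subspaces, so the bound means dimension at most one. Two such annihilators have
    sizes with product at most q^2 < q^n, which is the contradiction sought in [plane_residual]. *)
Definition good (x : B) : bool :=
  [forall mu, (#|annihilator (x - iota mu)%R| <= #|k|)%N].

Lemma good_not_scalar x a : good x -> x != iota a.
Proof.
move=> /forallP/(_ a) good_x; apply: contraTneq good_x => ->.
rewrite subrr -ltnNge -[ltnLHS]expn1.
suff -> : annihilator (0 : B) = setT by rewrite cardsT exp_gt.
by apply/setP => z; rewrite !inE mul0r eqxx.
Qed.

Lemma good_affine_eq0 x a c : good x -> iota a + iota c * x = 0 -> a = 0 /\ c = 0.
Proof.
move=> good_x eq0; have c0 : c = 0.
  apply/eqP; apply: contraT => c_neq0.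
  case/eqP: (good_not_scalar (- (c^-1 * a)) good_x).
  rewrite rmorphN rmorphM -[LHS]mul1r -(iota_inv c_neq0) mulrAC -mulrA [x * _]mulrC.
  by rewrite mulrCA; move/eqP: eq0; rewrite addrC addr_eq0 => /eqP->; rewrite mulrN.
split=> //; move: eq0; rewrite c0 rmorph0 mul0r addr0 => a0.
apply/eqP; apply: contraT => a_neq0; case/eqP: (good_not_scalar 0 good_x).
by rewrite rmorph0 -[x]mulr1 -(iota_inv a_neq0) a0 mul0r mulr0.
Qed.

Lemma card_plane x : good x -> #|plane x| = (#|k| ^ 2)%N.
Proof.
move=> good_x; rewrite card_imset ?card_prod ?mulnn // => -[a c] [a' c'] /= eqac.
have [] := @good_affine_eq0 x (a - a') (c - c') good_x.
  rewrite !rmorphB mulrBl addrACA -opprD eqac.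
  by rewrite addrC addNr.
by move=> /eqP; rewrite subr_eq0 => /eqP-> /eqP; rewrite subr_eq0 => /eqP->.
Qed.

Definition associated (x y : B) : bool :=
  [exists u, exists u', (u * u' == 1) && (plane y == [set u * z | z in plane x])].

Lemma associatedP x y :
  reflect (exists u u', u * u' = 1 /\ plane y = [set u * z | z in plane x])
          (associated x y).
Proof.
apply: (iffP existsP) => [[u /existsP[u' /andP[/eqP uu' /eqP eqp]]]|].
  by exists u, u'.
by case=> u [u' [uu' eqp]]; exists u; apply/existsP; exists u'; rewrite uu' -eqp !eqxx.
Qed.

Lemma associated_refl x : associated x x.
Proof.
apply/associatedP; exists 1, 1; rewrite mulr1; split=> //.
by rewrite (eq_imset _ (fun z => mul1r z)) imset_id.
Qed.

Lemma associated_sym x y : associated x y -> associated y x.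
Proof.
case/associatedP => u [u' [uu' eqp]]; apply/associatedP; exists u', u.
rewrite mulrC; split=> //; rewrite eqp -imset_comp -[LHS]imset_id.
by apply: eq_imset => z /=; rewrite mulrA [u' * u]mulrC uu' mul1r.
Qed.

(* If b <1, x> is contained in <1, y> and b is not a unit, then b kills some
   x - mu and is a multiple of some y - lam, so that q^n = |bB| |ann b| is at
   most |ann (x - mu)| |ann (y - lam)|. *)
Lemma plane_residual x y b :
  good x -> good y -> b != 0 -> plane x \subset residual (plane y) b ->
  associated x y.
Proof.
move=> good_x good_y b_neq0 /subsetP sub.
have [/existsP[z /and3P[xz z_neq0 /eqP bz0]]|noz] :=
  boolP [exists z, [&& z \in plane x, z != 0 & b * z == 0]]; last first.
  (* Here b kills no nonzero element of <1, x>, so b <1, x> has q^2 elements and equals <1, y>;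
     since 1 belongs to it, b is a unit. *)
  have inj_b : {in plane x &, injective (fun z => b * z)}.
    move=> z z' xz xz' eqbz; apply/eqP; rewrite -subr_eq0.
    apply: contraNT noz => zz'; apply/existsP; exists (z - z').
    by rewrite (subspaceB (subspace_plane x)) // zz' mulrBr eqbz subrr eqxx.
  have eqp : plane y = [set b * z | z in plane x].
    apply/esym/eqP; rewrite eqEcard card_in_imset // !card_plane // leqnn andbT.
    by apply/subsetP => _ /imsetP[z xz ->]; have := sub z xz; rewrite inE.
  have /imsetP[b' _ bb'] : 1 \in [set b * z | z in plane x] by rewrite -eqp plane1.
  by apply/associatedP; exists b, b'.
have /planeP[a [c eqz]] := xz.
(* Otherwise z is a nonzero scalar, and b z = 0 gives b = 0. *)
have c_neq0 : c != 0.
  apply: contraNneq b_neq0 => c0; have a_neq0 : a != 0.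
    by apply: contraNneq z_neq0 => a0; rewrite eqz a0 c0 !rmorph0 mul0r addr0.
  have za : z = iota a by rewrite eqz c0 rmorph0 mul0r addr0.
  by rewrite -[b]mulr1 -(iota_inv a_neq0) mulrA -za bz0 mul0r.
pose mu := - (c^-1 * a).
have eqx : x - iota mu = iota c^-1 * z.
  by rewrite eqz mulrDr mulrA iota_Vinv // mul1r rmorphN opprK addrC rmorphM.
have : b \in plane y by have := sub 1 (plane1 x); rewrite inE mulr1.
case/planeP => d [e eqb].
(* Otherwise b is a nonzero scalar, which cannot kill z. *)
have e_neq0 : e != 0.
  apply: contraNneq z_neq0 => e0; have d_neq0 : d != 0.
    by apply: contraNneq b_neq0 => d0; rewrite eqb d0 e0 !rmorph0 mul0r addr0.
  rewrite -[z]mul1r -(iota_inv d_neq0) mulrAC.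
  by move: bz0; rewrite eqb e0 rmorph0 mul0r addr0 => ->; rewrite mul0r.
pose lam := - (e^-1 * d).
have eqy : y - iota lam = iota e^-1 * b.
  by rewrite eqb mulrDr mulrA iota_Vinv // mul1r rmorphN opprK addrC rmorphM.
(* As x - mu and y - lam are scalar multiples of z and b, the ideal bB lies in ann (x - mu) and ann
   b lies in ann (y - lam). *)
have le1 : (#|principal b| <= #|k|)%N.
  apply: leq_trans (forallP good_x mu).
  apply/subset_leq_card/subsetP => _ /imsetP[t _ ->].
  by rewrite !inE eqx mulrA -[_ * z * b]mulrA [z * b]mulrC bz0 mulr0 mul0r.
have le2 : (#|annihilator b| <= #|k|)%N.
  apply: leq_trans (forallP good_y lam); apply/subset_leq_card/subsetP => t.
  by rewrite !inE eqy => /eqP bt; rewrite -mulrA bt mulr0.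
have := leq_mul le1 le2; rewrite card_principal_annihilator mulnn.
by rewrite leqNgt exp_gt.
Qed.

(** If <1, y> = u <1, x>, then 1 = u z' and y = u z with z, z' in <1, x>. Thus u is the inverse of
    z', and the pair (z', z) determines y. *)
Lemma card_associated x : (#|[set y | associated x y]| <= #|k| ^ 4)%N.
Proof.
(* The default 0 at non-units is harmless: the z' that matter are invertible. *)
pose inv (z' : B) : B := odflt 0 [pick u : B | u * z' == 1].
pose F (zz : B * B) := inv zz.1 * zz.2.
have sub : [set y | associated x y] \subset F @: setX (plane x) (plane x).
  apply/subsetP => y; rewrite inE => /associatedP[u [u' [uu' eqp]]].
  have /imsetP[z xz eqy] : y \in [set u * z | z in plane x] by rewrite -eqp plane_gen.
  have /imsetP[z' xz' eq1] : 1 \in [set u * z | z in plane x] by rewrite -eqp plane1.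
  apply/imsetP; exists (z', z); first by rewrite inE xz' xz.
  rewrite /F /inv /= eqy; case: pickP => [v /= /eqP vz'|/(_ u)]; last first.
    by rewrite -eq1 eqxx.
  by rewrite -[v]mulr1 eq1 mulrCA vz' mulr1.
apply: leq_trans (subset_leq_card sub) _.
apply: leq_trans (leq_imset_card _ _) _.
rewrite cardsX (_ : 4 = 2 + 2)%N // expnD.
by apply: leq_mul; exact: card_plane_le.
Qed.

(** If z = w_j u with u a unit, then ann z is no larger than ann w_j. So elements with annihilator
    larger than q lie in ideals w_j B with |ann w_j| >= q^2, each of size at most q^(n-2); bad
    elements are translates of these by the q scalars. *)
Lemma card_bad_le : (#|[set x | ~~ good x]| * #|k| <= #|T| * #|B|)%N.
Proof.
pose Z : {set B} := [set z | (#|k| < #|annihilator z|)%N].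
have leZ : (#|Z| * #|k| ^ 2 <= #|T| * #|B|)%N.
  pose P j := (#|k| < #|annihilator (w j)|)%N.
  have sub : Z \subset \bigcup_(j | P j) principal (w j).
    apply/subsetP => z; rewrite inE => gt_z.
    have [j [u [u' [uu' eqz]]]] := associates z.
    apply/bigcupP; exists j; last by rewrite eqz imset_f.
    apply: leq_trans gt_z _; rewrite eqz.
    rewrite -(card_imset (annihilator _) (f := fun t => u * t)); last first.
      by move=> t t' /(congr1 (fun s => u' * s)); rewrite !mulrA [u' * u]mulrC uu' !mul1r.
    apply/subset_leq_card/subsetP => _ /imsetP[t /[!inE] wt ->].
    by rewrite mulrA.
  apply: leq_trans (leq_mul (subset_leq_card sub) (leqnn _)) _.
  apply: leq_trans (leq_mul (leq_card_bigcup _ _) (leqnn _)) _.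
  rewrite big_distrl /= -sum_nat_const [leqLHS]big_mkcond /=.
  apply: leq_sum => j _; case: ifP => // gt_j.
  rewrite -(card_principal_annihilator (w j)) leq_mul2l.
  rewrite (card_subspace_sqr (iota := iota)) ?orbT //.
  exact: subspace_residual (subspace0 _).
have sub : [set x | ~~ good x] \subset \bigcup_(mu : k) [set z + iota mu | z in Z].
  apply/subsetP => x; rewrite inE negb_forall => /existsP[mu].
  rewrite -ltnNge => gt_x; apply/bigcupP; exists mu => //.
  by apply/imsetP; exists (x - iota mu); rewrite ?subrK // inE.
have le1 : (#|[set x | ~~ good x]| <= #|k| * #|Z|)%N.
  apply: leq_trans (subset_leq_card sub) _; apply: leq_trans (leq_card_bigcup _ _) _.
  by rewrite -sum_nat_const; apply: leq_sum => mu _; rewrite card_imset //; apply: addIr.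
apply: leq_trans leZ; apply: leq_trans (leq_mul le1 (leqnn _)) _.
by rewrite mulnAC mulnn mulnC.
Qed.

Lemma card_good_ge : (2 * #|T| <= #|k|)%N -> (#|B| <= 2 * #|[set x | good x]|)%N.
Proof.
move=> leTk; have le_bad : (2 * #|[set x | ~~ good x]| <= #|B|)%N.
  rewrite -(leq_pmul2r q_gt0) -mulnA.
  apply: leq_trans (leq_mul (leqnn 2) card_bad_le) _.
  by rewrite mulnA mulnC leq_mul2l leTk orbT.
have <- : (#|[set x | good x]| + #|[set x | ~~ good x]| = #|B|)%N.
  rewrite -(cardsC [set x | good x]); congr (_ + #|pred_of_set _|)%N.
  by apply/setP => x; rewrite !inE.
rewrite mul2n -addnn leq_add2l -(leq_add2r #|[set x | ~~ good x]|) addnn -mul2n.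
apply: leq_trans le_bad _.
rewrite -(cardsC [set x | good x]) leq_add2l subset_leq_card //.
by apply/subsetP => x; rewrite !inE.
Qed.

Lemma card_Star_ge : (2 * #|T| <= #|k|)%N ->
  exists N, (2 ^ N <= #|Star iota|)%N /\ (#|k| ^ n <= 2 * #|k| ^ 4 * N)%N.
Proof.
(* [D] will be a maximal set of pairwise non-associated good elements, and N = |D|. *)
move=> leTk; pose P (D : {set B}) := (D \subset [set x | good x]) &&
  [forall x in D, forall y in D, associated x y ==> (x == y)].
have P0 : P set0.
  by rewrite /P sub0set; apply/forall_inP => x; rewrite inE.
have [D /maxsetP[/andP[/subsetP goodD /forall_inP indepD] maxD] _] := maxset_exists P0.
exists #|D|; split; last first.
  (* By maximality the association classes of [D] cover all good elements; each class has at most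
     q^4 elements. *)
  have sub : [set x | good x] \subset \bigcup_(x in D) [set y | associated x y].
    apply/subsetP => x; rewrite inE => good_x.
    apply: contraT => /bigcupP no_assoc.
    suff Dx : x \in D by case: no_assoc; exists x; rewrite ?inE ?associated_refl.
    suff <- : x |: D = D by rewrite setU11.
    apply: maxD; last exact: subsetUr.
    apply/andP; split.
      by apply/subsetP => y; rewrite !inE => /predU1P[->//|/goodD]; rewrite inE.
    apply/forall_inP => y /setU1P[->|Dy]; apply/forall_inP => z /setU1P[->|Dz].
    + by rewrite eqxx implybT.
    + apply/implyP => /associated_sym xz; case: no_assoc.
      by exists z; rewrite ?inE.
    + by apply/implyP => yx; case: no_assoc; exists y; rewrite ?inE.
    + by have /forall_inP := indepD y Dy; apply.
  rewrite -card_B; apply: leq_trans (card_good_ge leTk) _.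
  rewrite -mulnA leq_mul2l /=; apply: leq_trans (subset_leq_card sub) _.
  apply: leq_trans (leq_card_bigcup _ _) _; rewrite mulnC -sum_nat_const.
  by apply: leq_sum => x _; exact: card_associated.
(* Including [base] makes k closed. *)
pose E (Y : {set B}) : {set {set B}} := base iota |: [set plane x | x in Y].
have subE Y L : L \in E Y -> is_subspace iota L.
  case/setU1P => [->|/imsetP[x _ ->]]; last exact: subspace_plane.
  by have := base_in_F0 iota; rewrite inE => /andP[].
pose S Y := generated_star (subE Y).
have fixS (Y : {set B}) x : Y \subset D -> x \in D ->
    (S Y (planeF0 x) == planeF0 x) = (x \in Y).
  move=> /subsetP sYD Dx; apply/eqP/idP => [/(congr1 val)|Yx]; last first.
    by apply: generated_star_fix; apply/setU1P; right; exact: imset_f.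
  rewrite ffunE /= => fixx; apply: contraT => Yx.
  have good_x : good x by have := goodD _ Dx; rewrite inE.
  (* For x outside [Y], only b = 0 places <1, x> inside (L : b) with L in [E Y], so the closure of
     <1, x> is all of B. *)
  suff : (#|B| <= #|plane x|)%N by rewrite leqNgt card_plane // exp_gt.
  rewrite -fixx; apply/subset_leq_card/subsetP => t _.
  apply/mem_residual_closure => L b /setU1P EL sub.
  have [->|b_neq0] := eqVneq b 0.
    rewrite mul0r; suff /is_subspaceP[] : is_subspace iota L by [].
    by apply: (subE Y); apply/setU1P.
  case: EL => [eqL|/imsetP[y Yy eqL]]; last first.
    rewrite eqL in sub; have Dy := sYD y Yy.
    have good_y : good y by have := goodD _ Dy; rewrite inE.
    have /forall_inP/(_ y Dy)/implyP := indepD x Dx.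
    move/(_ (plane_residual good_x good_y b_neq0 sub)) => /eqP eqxy.
    by rewrite eqxy Yy in Yx.
  (* For L = k, both b and b x are scalars, which makes x a scalar, against goodness. *)
  rewrite eqL in sub; have /imsetP[a _ eqb] : b \in base iota.
    by have := subsetP sub 1 (plane1 x); rewrite inE mulr1.
  have /imsetP[c _ eqbx] : b * x \in base iota.
    by have := subsetP sub x (plane_gen x); rewrite inE.
  have a_neq0 : a != 0 by apply: contraNneq b_neq0 => a0; rewrite eqb a0 rmorph0.
  case/eqP: (good_not_scalar (a^-1 * c) good_x).
  by rewrite rmorphM -eqbx eqb mulrA -rmorphM mulVf // rmorph1 mul1r.
rewrite -card_powerset -(card_in_imset (f := S)).
  apply/subset_leq_card/subsetP => _ /imsetP[Y _ ->].
  by apply: generated_star_in; apply/setU1P; left.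
move=> Y Y'; rewrite !inE => sYD sY'D eqS; apply/setP => x.
have [Dx|nDx] := boolP (x \in D); first by rewrite -(fixS Y) // -(fixS Y') // eqS.
by rewrite (contraNF (subsetP sYD x) nDx) (contraNF (subsetP sY'D x) nDx).
Qed.

End LowerBound.

(** * The algebras B_s *)

Section FiniteAlgebra.

Variables (s : seq (nat * nat)).
Hypothesis s_pos : forall ef, ef \in s -> (0 < ef.1)%N /\ (0 < ef.2)%N.

Let ef (i : 'I_(size s)) := tnth (in_tuple s) i.

Let ef_pos i : (0 < (ef i).1)%N /\ (0 < (ef i).2)%N.
Proof. by apply: s_pos; exact: mem_tnth. Qed.

Lemma card_B_alg (k : finFieldType) : #|B_alg k s| = (#|k| ^ dim_seq s)%N.
Proof.
rewrite /dim_seq big_tnth expn_sum.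
rewrite [LHS](card_dep_ffun (fun i => truncated k (ef i))) foldrE big_map big_enum.
by apply: eq_bigr => i _; have [e0 f0] := ef_pos i; rewrite card_truncated.
Qed.

(** Depends on [s] alone and not on the field, so its size is negligible against q for large q. *)
Definition exponents : finType := {dffun forall i, 'I_(ef i).2.+1}.

Definition monomial (k : finFieldType) (v : exponents) : B_alg k s :=
  [ffun i => in_qpoly 'X^((ef i).2) 'X^(v i) : truncated k (ef i)].

Lemma B_alg_associates (k : finFieldType) (z : B_alg k s) :
  exists v u u', u * u' = 1 /\ z = monomial k v * u.
Proof.
have /fin_all_exists[g gP] (i : 'I_(size s)) :
    exists vuu : 'I_(ef i).2.+1 * (truncated k (ef i) * truncated k (ef i)),
      vuu.2.1 * vuu.2.2 = 1 /\ z i = in_qpoly 'X^((ef i).2) 'X^(vuu.1) * vuu.2.1.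
  have [_ f0] := ef_pos i.
  by have [v [u [u' vuu']]] := qpolyXn_factor (z i) f0; exists (v, (u, u')).
exists [ffun i => (g i).1], [ffun i => (g i).2.1], [ffun i => (g i).2.2].
by split; apply/ffunP => i; have [gu gz] := gP i; rewrite !ffunE.
Qed.

End FiniteAlgebra.

(** * Asymptotics *)

Lemma Lambda_le (s : seq (nat * nat)) (q : nat) :
  (forall ef, ef \in s -> (0 < ef.1)%N /\ (0 < ef.2)%N) ->
  prime_power q -> (0 < dim_seq s)%N -> (#|exponents s| < q)%N ->
  (Lambda s q <= 2 ^ ((\sum_(r < dim_seq s) (dim_seq s).-1 ^ r)
                        * q ^ (((dim_seq s).-1 * (dim_seq s).-1) %/ 4)))%N.
Proof.
move=> s_pos q_pp n_gt0 lt_q; have cardq := card_GF q_pp.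
apply: leq_trans (card_Star_le _ (B_alg_associates s_pos (k := GF q)) _) _.
  by rewrite cardq.
rewrite leq_exp2l //.
have := card_subspaces1_le (B_map (GF q) s) n_gt0 (card_B_alg s_pos _).
by rewrite cardq.
Qed.

Lemma Lambda_ge (s : seq (nat * nat)) (q : nat) :
  (forall ef, ef \in s -> (0 < ef.1)%N /\ (0 < ef.2)%N) ->
  prime_power q -> (3 <= dim_seq s)%N -> (2 * #|exponents s| <= q)%N ->
  exists N, (2 ^ N <= Lambda s q)%N /\ (0 < N)%N /\ (q ^ (dim_seq s - 4) <= 2 * N)%N.
Proof.
move=> s_pos q_pp n_ge3 le_q; have cardq := card_GF q_pp.
have q_gt0 : (0 < q)%N by rewrite -cardq (ltnW (finNzRing_gt1 _)).
have le_k : (2 * #|exponents s| <= #|GF q|)%N by rewrite cardq.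
have [N [leN le_qn]] := card_Star_ge (B_map (GF q) s)
  (B_alg_associates s_pos (k := GF q)) (card_B_alg s_pos _) n_ge3 le_k.
rewrite cardq in le_qn; exists N; split=> //.
have N_gt0 : (0 < N)%N.
  by case: N le_qn {leN} => //; rewrite muln0 leqn0 expn_eq0 -leqn0 leqNgt q_gt0.
split=> //; have [ge4|lt4] := leqP 4 (dim_seq s).
  rewrite -(@leq_pmul2r (q ^ 4)) ?expn_gt0 ?q_gt0 // -expnD subnK //.
  by rewrite mulnAC.
(* For n = 3 the truncated exponent n - 4 is 0, and N > 0 suffices. *)
by rewrite (eqP (ltnW lt4)) expn0 muln_gt0.
Qed.

Section Asymptotics.

Variable R : realType.

(** A constant factor C shifts the logarithm in base q by [ln C / ln q], which tends to 0; at x = 0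
    the value is -oo. *)
Lemma logb_le (q C e : nat) (x : R) : (1 < q)%N -> (0 < C)%N -> 0 <= x ->
  x <= (C * q ^ e)%:R -> (logb q%:R x <= (e%:R + ln C%:R / ln q%:R)%:E)%E.
Proof.
move=> q_gt1 C_gt0 x_ge0 le_x; rewrite /logb; case: eqVneq => [_|x_neq0].
  exact: leNye.
have lnq : 0 < ln (q%:R : R) by rewrite ln_gt0 // ltr1n.
have q_gt0 : (0 : R) < q%:R by rewrite ltr0n (ltnW q_gt1).
have x_gt0 : 0 < x by rewrite lt0r x_neq0.
rewrite lee_fin ler_pdivrMr // mulrDl divfK ?gt_eqF //.
apply: (@le_trans _ _ (ln (C * q ^ e)%:R)).
  by rewrite ler_ln // posrE (lt_le_trans x_gt0).
rewrite natrM natrX lnM ?posrE ?exprn_gt0 // ?ltr0n //.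
by rewrite lnXn // addrC mulr_natl.
Qed.

Lemma logb_ge (q C e N : nat) (x : R) : (1 < q)%N -> (0 < C)%N -> (0 < N)%N ->
  (q ^ e <= C * N)%N -> N%:R <= x ->
  ((e%:R - ln C%:R / ln q%:R)%:E <= logb q%:R x)%E.
Proof.
move=> q_gt1 C_gt0 N_gt0 le_N le_x.
have N0 : (0 : R) < N%:R by rewrite ltr0n.
have x_gt0 : 0 < x by exact: lt_le_trans le_x.
have lnq : 0 < ln (q%:R : R) by rewrite ln_gt0 // ltr1n.
have q_gt0 : (0 : R) < q%:R by rewrite ltr0n (ltnW q_gt1).
rewrite /logb gt_eqF // lee_fin ler_pdivlMr // mulrBl divfK ?gt_eqF //.
apply: (@le_trans _ _ (ln N%:R)); last by rewrite ler_ln ?posrE.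
rewrite lerBlDr addrC -lnM ?posrE ?ltr0n // [e%:R * _]mulr_natl -lnXn //.
by rewrite ler_ln ?posrE ?exprn_gt0 ?mulr_gt0 // ?ltr0n // -natrX -natrM ler_nat.
Qed.

Lemma div_ln_le (C : R) (eps : R) : 0 < eps ->
  exists Q : nat, forall q, (Q <= q)%N -> C / ln q%:R <= eps.
Proof.
(* The summand 1 keeps [A] positive even for C = 0, so that ln q > A is positive. *)
move=> eps_gt0; pose A := `|C| / eps + 1.
have A_gt0 : 0 < A by rewrite ltr_wpDl // divr_ge0 // ltW.
exists (Num.bound (expR A)) => q le_q.
have lt_q : expR A < q%:R.
  apply: lt_le_trans (archi_boundP (expR_ge0 A)) _; by rewrite ler_nat.
have lt_ln : A < ln q%:R.
  by rewrite -[A]expRK ltr_ln // ?posrE ?expR_gt0 // (lt_trans (expR_gt0 A)).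
have ln_gt0 : 0 < ln (q%:R : R) by exact: lt_trans lt_ln.
rewrite ler_pdivrMr // (le_trans (ler_norm C)) // mulrC -ler_pdivrMr //.
by apply: ltW; apply: lt_trans lt_ln; rewrite ltrDl.
Qed.

Lemma limsup_pp_le (u : nat -> \bar R) (c : R) :
  (forall eps : R, 0 < eps -> exists Q, forall q, prime_power q -> (Q <= q)%N ->
     (u q <= (c + eps)%:E)%E) ->
  (limsup_pp u <= c%:E)%E.
Proof.
move=> H; apply/lee_addgt0Pr => eps eps_gt0; have [Q uQ] := H eps eps_gt0.
rewrite /limsup_pp limf_esupE; apply: ge_ereal_inf.
pose V : set nat := fun q => prime_power q /\ (Q <= q)%N.
exists (ereal_sup (u @` V)%classic).
  by exists V => //; exists Q => // q Qq pp_q; split.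
by apply: ge_ereal_sup => _ [q [pp_q Qq] <-]; rewrite -EFinD; apply: uQ.
Qed.

Lemma liminf_pp_ge (u : nat -> \bar R) (c : R) :
  (forall eps : R, 0 < eps -> exists Q, forall q, prime_power q -> (Q <= q)%N ->
     ((c - eps)%:E <= u q)%E) ->
  (c%:E <= liminf_pp u)%E.
Proof.
move=> H; apply/lee_subgt0Pr => eps eps_gt0; have [Q uQ] := H eps eps_gt0.
rewrite /liminf_pp limf_einfE; apply: le_ereal_sup_tmp.
pose V : set nat := fun q => prime_power q /\ (Q <= q)%N.
exists (ereal_inf (u @` V)%classic).
  by exists V => //; exists Q => // q Qq pp_q; split.
by apply: le_ereal_inf_tmp => _ [q [pp_q Qq] <-]; rewrite -EFinB; apply: uQ.
Qed.

(** Any two tails share a prime power, namely a large power of 2, so the infimum over one is at most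
    the supremum over the other. *)
Lemma liminf_pp_le_limsup_pp (u : nat -> \bar R) : (liminf_pp u <= limsup_pp u)%E.
Proof.
rewrite /liminf_pp /limsup_pp limf_esupE limf_einfE.
apply: ge_ereal_sup => _ [V [M _ VM] <-].
apply: le_ereal_inf_tmp => _ [W [N _ WN] <-].
pose m := maxn M N; pose q := (2 ^ m.+1)%N.
have pp_q : prime_power q by exists 2%N, m.+1.
have le_mq : (m <= q)%N by rewrite ltnW // ltnW // ltn_expl.
have Vq : V q by apply: VM => //=; apply: leq_trans le_mq; exact: leq_maxl.
have Wq : W q by apply: WN => //=; apply: leq_trans le_mq; exact: leq_maxr.
apply: (@le_trans _ _ (u q)); first by apply: ereal_inf_lbound; exists q.
by apply: ereal_sup_ubound; exists q.
Qed.

Lemma prime_power_gt1 (q : nat) : prime_power q -> (1 < q)%N.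
Proof.
case=> p [m [p_pr m_gt0 ->]].
by rewrite -(expn0 p) ltn_exp2l // prime_gt1.
Qed.

(** * Limits of theta *)

Variable s : seq (nat * nat).
Hypothesis s_pos : forall ef, ef \in s -> (0 < ef.1)%N /\ (0 < ef.2)%N.

Let ln2_gt0 : 0 < ln (2 : R).
Proof. by rewrite ln_gt0 // ltr1n. Qed.

Lemma limsup_theta_le : (0 < dim_seq s)%N ->
  (limsup_pp (theta R s) <= (((dim_seq s).-1 * (dim_seq s).-1) %/ 4)%:R%:E)%E.
Proof.
move=> n_gt0; apply: limsup_pp_le => eps eps_gt0.
set n := dim_seq s in n_gt0 *; set e := (_ %/ 4)%N.
pose C := (\sum_(r < n) n.-1 ^ r)%N.
have C_gt0 : (0 < C)%N by rewrite /C -(prednK n_gt0) big_ord_recl.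
have [Q lnQ] := div_ln_le (ln C%:R) eps_gt0.
exists (maxn Q #|exponents s|.+1) => q pp_q; rewrite geq_max => /andP[Qq Jq].
have q_gt1 := prime_power_gt1 pp_q.
apply: (@le_trans _ _ (e%:R + ln C%:R / ln q%:R)%:E); last first.
  by rewrite lee_fin lerD2l lnQ.
have le_L := Lambda_le s_pos pp_q n_gt0 Jq.
apply: logb_le => //.
  (* The convention [ln 0 = 0] settles the value 0. *)
  case: (Lambda s q) => [|L]; first by rewrite ln0 // mul0r.
  by rewrite divr_ge0 ?ln_ge0 ?ler1n // ltW.
have [->|L_gt0] := posnP (Lambda s q); first by rewrite ln0 // mul0r.
rewrite ler_pdivrMr // mulr_natl -lnXn // ler_ln ?posrE ?exprn_gt0 ?ltr0n //.
by rewrite -natrX ler_nat.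
Qed.

Lemma liminf_theta_ge : (3 <= dim_seq s)%N ->
  ((dim_seq s - 4)%:R%:E <= liminf_pp (theta R s))%E.
Proof.
move=> n_ge3; apply: liminf_pp_ge => eps eps_gt0.
have [Q lnQ] := div_ln_le (ln 2%:R) eps_gt0.
exists (maxn Q (2 * #|exponents s|)) => q pp_q; rewrite geq_max => /andP[Qq Jq].
have [N [leN [N_gt0 qN]]] := Lambda_ge s_pos pp_q n_ge3 Jq.
apply: (@le_trans _ _ ((dim_seq s - 4)%:R - ln 2%:R / ln q%:R)%:E).
  by rewrite lee_fin lerD2l lerN2 lnQ.
apply: (logb_ge (N := N)) => //; first exact: prime_power_gt1.
rewrite ler_pdivlMr // mulr_natl -lnXn // ler_ln ?posrE ?exprn_gt0 ?ltr0n //.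
  by rewrite -natrX ler_nat.
by apply: leq_trans leN; rewrite expn_gt0.
Qed.

End Asymptotics.

(* The lower bounds need n >= 3: for n <= 2 there is exactly one star operation,
   so theta is constantly -oo and no finite lower bound holds. *)
Theorem theorem5p9 (R : realType) (s : seq (nat * nat)) (n : nat)
    (s_nonempty : s <> [::])
    (s_pos : forall ef, ef \in s -> (0 < ef.1)%N /\ (0 < ef.2)%N)
    (n_def : n = dim_seq s) :
  (~~ odd n ->
     [/\ (3 <= n)%N -> (((n%:R - 4) / 2)%:E <= liminf_pp (theta R s))%E,
         (liminf_pp (theta R s) <= limsup_pp (theta R s))%E &
         (limsup_pp (theta R s) <= ((n%:R * (n%:R - 2)) / 4)%:E)%E]) /\
  (odd n ->
     [/\ (3 <= n)%N -> (((n%:R - 3) / 2)%:E <= liminf_pp (theta R s))%E,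
         (liminf_pp (theta R s) <= limsup_pp (theta R s))%E &
         (limsup_pp (theta R s) <= (((n%:R - 1) ^+ 2) / 4)%:E)%E]).
Proof.
have n_gt0 : (0 < n)%N.
  case: s s_nonempty s_pos n_def => // ef s' _ s'_pos ->.
  have [e_gt0 f_gt0] := s'_pos ef (mem_head _ _).
  by rewrite /dim_seq big_cons addn_gt0 muln_gt0 e_gt0 f_gt0.
have upper := limsup_theta_le R s_pos; rewrite -n_def in upper.
have lower := liminf_theta_ge R s_pos; rewrite -n_def in lower.
have low := liminf_pp_le_limsup_pp (theta R s).
have leE : (4 <= n)%N -> (n - 4)%:R = n%:R - 4 :> R by move=> ?; rewrite natrB.
split=> n_odd; split=> //.
- move=> n3; apply: le_trans (lower n3); rewrite lee_fin.
  (* An even n >= 3 is at least 4, and then n - 4 >= (n - 4) / 2. *)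
  have n4 : (4 <= n)%N by case: n n3 n_odd {n_def n_gt0 upper lower leE} => [|[|[|[|]]]].
  rewrite leE // ler_pdivrMr ?ltr0n // ler_peMr ?ler1n // subr_ge0 ler_nat //.
- apply: le_trans (upper n_gt0) _; rewrite lee_fin ler_pdivlMr ?ltr0n //.
  have -> : n%:R * (n%:R - 2) = (n * (n - 2))%:R :> R.
    by rewrite natrM natrB //; case: n n_gt0 n_odd {n_def upper lower leE} => [|[]].
  (* For n = 2m + 2, both floor((n - 1)^2 / 4) and n (n - 2) / 4 equal m (m + 1). *)
  rewrite -natrM ler_nat; have [m ->] : exists m, n = m.*2.+2.
    exists n.-2./2; case: n n_gt0 n_odd {n_def upper lower leE} => [|[|m]] //= _.
    by rewrite negbK => /even_halfK->.
  by rewrite /= subn2 /=; nia.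
- move=> n3; apply: le_trans (lower n3); rewrite lee_fin.
  (* For n = 3 the claimed bound is 0, the truncated value of n - 4; for n >= 5, n - 4 >= (n - 3) /
     2. *)
  have [n4|] := leqP 5 n; last first.
    case: n n3 n_odd {n_def n_gt0 upper lower leE} => [|[|[|[|[|]]]]] // _ _ _.
    by rewrite subrr mul0r.
  rewrite leE ?(ltnW n4) // ler_pdivrMr ?ltr0n //.
  have n5 : (5 : R) <= n%:R by rewrite ler_nat.
  by lra.
- apply: le_trans (upper n_gt0) _; rewrite lee_fin ler_pdivlMr ?ltr0n //.
  have -> : n%:R - 1 = n.-1%:R :> R by rewrite -subn1 natrB.
  by rewrite -natrX -natrM ler_nat -mulnn leq_divM.
Qed.
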